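(* Let $m\ge 2$ and $n\ge 1$ be integers, let $(Y,+)$ be an $(n!)$-divisible Abelian group, and let $X$ be the additive semigroup $(\mathbb{R},+)$ if $m$ is odd and $([0,\infty),+)$ if $m$ is even. Let $f:\mathbb{R}\to Y$ be a function. Then $f$ satisfies $$f(u)+\sum_{i=1}^{n+1}(-1)^{i}\binom{n+1}{i} f\left(\sqrt[m]{u^{m}+iv^{m}}\right)=0\quad\text{for all }u,v\in\mathbb{R}$$ if and only if there exists $\rho_i\in\mathcal{M}_i(X,Y)$ for all $i\in\{0,1,\dots,n\}$ such that $$f(u)=\rho_0(u^{m})+\rho_1(u^{m})+\cdots+\rho_n(u^{m})\quad\text{for all }u\in\mathbb{R}.$$
   Context: An Abelian group $(Y,+)$ is called $(n!)$-divisible if the homomorphism $Y\to Y$, $y\mapsto (n!)y$, is an isomorphism (so it is bijective). For a commutative semigroup $(X,+)$, a nonnegative integer $j$, $y\in X$ and $\rho:X\to Y$, put $\Delta_y^{j}\rho(x):=\sum_{i=0}^{j}(-1)^{j-i}\binom{j}{i}\rho(x+iy)$ for $x\in X$ (the term $i=0$ is $\rho(x)$ up to sign). The set $\mathcal{M}_j(X,Y)$ of $j$-monomials consists of all functions $\rho:X\to Y$ with $\Delta_y^{j}\rho(x)=(j!)\rho(y)$ for all $x,y\in X$ (for $j=0$: the constant functions). Here $\sqrt[m]{\cdot}$ is the real $m$-th root: for odd $m$ it is the inverse of $t\mapsto t^m$ on $\mathbb{R}$; for even $m$ it is the nonnegative root of a nonnegative number. *)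

(* Defs.v *)
From HB Require Import structures.
From mathcomp Require Import all_boot all_order all_algebra.
From mathcomp Require Import boolp classical_sets reals exp.
Set Implicit Arguments.
Unset Strict Implicit.
Unset Printing Implicit Defensive.
Import Order.TTheory GRing.Theory Num.Theory.
Local Open Scope classical_set_scope.
Local Open Scope ring_scope.

Definition fact_divisible (n : nat) (Y : zmodType) : Prop :=
  bijective (fun y : Y => y *+ n`!).

(* [addSemigroupType] is commutative but need not have a zero, so [x + i y]
   is written as the i-fold addition of [y] to [x]; for i = 0 it is [x]. *)
Definition translate (X : addSemigroupType) (x y : X) (i : nat) : X :=
  iter i (fun z => z + y) x.

Lemma translateE (X : nmodType) (x y : X) (i : nat) : translate x y i = x + y *+ i.
Proof.
by elim: i => [|i IHi]; rewrite /translate ?mulr0n ?addr0//= -/(translate x y i) IHi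
  mulrSr addrA.
Qed.

Definition fdiff (X : addSemigroupType) (Y : zmodType) (j : nat) (y : X)
    (rho : X -> Y) (x : X) : Y :=
  \sum_(i < j.+1) rho (translate x y i) *~ ((-1) ^+ (j - i) * ('C(j, i))%:Z).

Definition monomial (X : addSemigroupType) (Y : zmodType) (j : nat)
    (rho : X -> Y) : Prop :=
  forall x y : X, fdiff j y rho x = rho y *+ j`!.

(* For even m and negative x there is no root, and the value is the default 0;
   otherwise the root exists and is unique. *)
Definition real_root (R : realType) (m : nat) (x : R) : R :=
  xget 0 [set y | y ^+ m = x /\ (odd m || (0 <= y))].

Lemma real_root_uniq (R : realType) (m : nat) (y z : R) : (0 < m)%N ->
  odd m || (0 <= y) -> odd m || (0 <= z) -> y ^+ m = z ^+ m -> y = z.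
Proof.
move=> m0; have [om _ _|em /= y0 z0] := boolP (odd m); last first.
  by move/eqP; rewrite eqrXn2// => /eqP.
have ge0X (t : R) : (0 <= t ^+ m) = (0 <= t).
  apply/idP/idP => [|/exprn_ge0]; last exact.
  by apply: contraLR; rewrite -!ltNge exprn_odd_lt0.
move=> yz; have := congr1 (fun t => 0 <= t) yz; rewrite !ge0X => syz.
have [y0|y0] := leP 0 y.
  by apply/eqP; rewrite -(@eqrXn2 _ m)// -?syz//; apply/eqP.
have z0 : z < 0 by rewrite ltNge -syz -ltNge.
apply/oppr_inj/eqP; rewrite -(@eqrXn2 _ m)// ?oppr_ge0 1?ltW//.
by rewrite exprNn yz -exprNn.
Qed.

Lemma real_root_spec (R : realType) (m : nat) (x : R) : (0 < m)%N ->
  odd m || (0 <= x) -> real_root m x ^+ m = x /\ (odd m || (0 <= real_root m x)).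
Proof.
move=> m0 mx.
have powRK (t : R) : 0 <= t -> (t `^ m%:R^-1) ^+ m = t.
  by move=> t0; rewrite -powR_mulrn ?powR_ge0// -powRrM mulVf ?powRr1//
    pnatr_eq0 -lt0n.
suff [y Py] : exists y, y ^+ m = x /\ (odd m || (0 <= y)).
  by rewrite /real_root; case: xgetP => [z _ []//|/(_ y)].
have [x0|x0] := leP 0 x.
  by exists (x `^ m%:R^-1); rewrite powRK// powR_ge0 orbT.
have om : odd m by move: mx; rewrite leNgt x0 orbF.
exists (- ((- x) `^ m%:R^-1)); rewrite om; split=> //.
by rewrite exprNn -signr_odd om expr1 powRK ?oppr_ge0 1?ltW// mulN1r opprK.
Qed.

Lemma real_root_odd_bij (R : realType) (m : nat) : odd m ->
  cancel (fun t : R => t ^+ m) (real_root m) /\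
  cancel (real_root m) (fun t : R => t ^+ m).
Proof.
move=> om; have m0 : (0 < m)%N by case: m om.
have K (x : R) : real_root m x ^+ m = x by have [|] := @real_root_spec R m x m0; rewrite ?om.
by split=> // t; apply: (@real_root_uniq R m) => //; rewrite ?om.
Qed.

Definition halfline (R : realType) : Type := {x : R | x \is Num.nneg}.
HB.instance Definition _ (R : realType) := SubChoice.on (halfline R).

Lemma nneg_addr_closed (R : realType) :
  addr_closed (fun x : R => x \is Num.nneg).
Proof.
by split=> [|x y]; rewrite !unfold_in/= ?lexx// => x0 y0; rewrite addr_ge0.
Qed.

HB.instance Definition _ (R : realType) :=
  GRing.SubChoice_isSubNmodule.Build R _ (halfline R) (@nneg_addr_closed R).

Definition domX (R : realType) (oddm : bool) : addSemigroupType :=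
  if oddm then R : addSemigroupType else halfline R : addSemigroupType.

Lemma exprn_nneg (R : realType) (m : nat) (u : R) :
  odd m = false -> u ^+ m \is Num.nneg.
Proof. by move=> em; rewrite nnegrE exprn_even_ge0// em. Qed.

(* [u ^+ m] as an element of X; the case distinction only attaches the proof of
   nonnegativity when m is even. *)
Definition powX_parity (R : realType) (m : nat) (u : R) (b : bool) :
    odd m = b -> domX R b :=
  match b return odd m = b -> domX R b with
  | true => fun _ => u ^+ m
  | false => fun em => exist _ (u ^+ m) (exprn_nneg u em)
  end.

Definition powX (R : realType) (m : nat) (u : R) : domX R (odd m) :=
  powX_parity u (erefl (odd m)).

(* Main.v *)
Require Import Defs.
From mathcomp Require Import all_boot all_order all_algebra.
From mathcomp Require Import reals.
From mathcomp Require Import ring.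
From mathcomp Require boolp.
Import Order.TTheory GRing.Theory Num.Theory.
Local Open Scope ring_scope.

(** Put [g := f \o real_root m].  Through [u |-> u ^+ m] the functional equation
    becomes Frechet's equation [fdiff n.+1 y g x = 0] on the monoid [X], and the
    theorem says that its solutions are the sums of monomials of degree at most
    [n].  The only property of [X] that matters is divisibility.

    Sums of monomials are solutions, because [fdiff i y rho] is constant when
    [rho] is an [i]-monomial, and one further difference kills it.

    Conversely, a solution [g] is decomposed by induction on [n], peeling off the
    top monomial, which has to be [rho y := fdiff n y g 0 / n!].  Subtracting it
    lowers the degree by one as soon as [fdiff n y g x] does not depend on [x],
    that is, as soon as the mixed difference of [g] with one step [z] and [n]
    steps [y] vanishes.  This is Djokovic's theorem [mixed_diff_eq0]: over a
    divisible monoid, if all differences of order [N] with a repeated step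
    vanish, then so do those with [N] arbitrary steps.  Write [T^a] for the
    translation by [a] and [c_k] for the coefficients of [fdiff N].  Expanding
    the product turns
      [\sum_(k <= N) c_k * \prod_(r < N) (T^(k w_r) - T^(r w_r))]
    into a combination of differences of order [N] with a repeated step, so it
    kills [g].  But its terms with [k < N] are zero because of the factor
    [r = k], and the last one is the mixed difference with steps
    [(N - r) w_r], which are arbitrary, translated by some [b].  The translation
    is removed by a last use of the equation, with step [b].  No step of the
    argument subtracts in [X], so that it covers the half-line.

    That [rho] is a monomial ([monomial_top]) follows from
    [fdiff n (k y) g = k ^ n * fdiff n y g] and from the value [n!] of the [n]-th
    difference of [k |-> k ^ n]. *)

(** * Polynomials in a translation *)

(** The polynomial [p] evaluated at the translation by [y], applied to [g].
    Identities between iterated differences then reduce to identities in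
    [{poly int}], as [fdiff j y] is the value of [('X - 1) ^+ j]. *)
Definition shiftp {X : nmodType} {Y : zmodType} (p : {poly int}) (y : X)
    (g : X -> Y) (x : X) : Y :=
  \sum_(i < size p) g (x + y *+ i) *~ p`_i.

Lemma coef_XsubC1X j i : (i <= j)%N ->
  (('X - 1) ^+ j : {poly int})`_i = (-1) ^+ (j - i) * ('C(j, i))%:Z.
Proof.
move=> ij; rewrite addrC exprDn.
rewrite (_ : \sum_(k < j.+1) _
   = \poly_(k < j.+1) ((-1) ^+ (j - k) * ('C(j, k))%:Z)).
  by rewrite coef_poly ltnS ij.
rewrite poly_def; apply: eq_bigr => k _.
rewrite -mul_polyC polyCM polyC_exp polyCN -mulrnAl -mulr_natr.
by congr (_ * _ * _); rewrite -polyC_natr natz.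
Qed.

Section ShiftPolynomials.
Set Implicit Arguments.
Unset Strict Implicit.
Variables (X : nmodType) (Y : zmodType).
Implicit Types (g h : X -> Y) (p q : {poly int}) (x y : X).

Lemma shiftp_wide N p y g x : (size p <= N)%N ->
  shiftp p y g x = \sum_(i < N) g (x + y *+ i) *~ p`_i.
Proof.
move=> pN; rewrite /shiftp (big_ord_widen N (fun i => g (x + y *+ i) *~ p`_i))//.
rewrite big_mkcond; apply: eq_bigr => i _; case: ltnP => // pi.
by rewrite nth_default.
Qed.

Lemma eq_shiftp p y g h x : g =1 h -> shiftp p y g x = shiftp p y h x.
Proof. by move=> gh; apply: eq_bigr => i _; rewrite gh. Qed.

Lemma shiftpD p q y g x :
  shiftp (p + q) y g x = shiftp p y g x + shiftp q y g x.
Proof.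
pose N := maxn (size p) (size q).
rewrite !(@shiftp_wide N) ?leq_maxl ?leq_maxr ?size_polyD// -big_split/=.
by apply: eq_bigr => i _; rewrite coefD mulrzDr.
Qed.

Lemma shiftpC c y g x : shiftp c%:P y g x = g x *~ c.
Proof.
by rewrite (@shiftp_wide 1) ?size_polyC_leq1// big_ord1 mulr0n addr0 coefC.
Qed.

Lemma shiftpMX p y g x : shiftp (p * 'X) y g x = shiftp p y g (x + y).
Proof.
rewrite (@shiftp_wide (size p).+1) ?size_polyMX_leq//; last first.
  by apply: leq_trans (size_polyMleq _ _) _; rewrite size_polyX addn2.
rewrite big_ord_recl/= coefMX mulr0z add0r.
by apply: eq_bigr => i _; rewrite coefMX/= /bump/= mulrS addrA.
Qed.

Lemma shiftp_sub p y g h x :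
  shiftp p y (fun t => g t - h t) x = shiftp p y g x - shiftp p y h x.
Proof. by rewrite /shiftp -sumrB; apply: eq_bigr => i _; rewrite mulrzBl. Qed.

Lemma shiftp_addr p y z g x :
  shiftp p y (fun t => g (t + z)) x = shiftp p y g (x + z).
Proof. by apply: eq_bigr => i _; rewrite addrAC. Qed.

Lemma shiftp_mul p q y g x :
  shiftp (p * q) y g x = shiftp p y (shiftp q y g) x.
Proof.
elim/poly_ind: p x => [|p c IHp] x; first by rewrite mul0r /shiftp size_poly0 !big_ord0.
rewrite mulrDl mulrAC !shiftpD !shiftpMX IHp shiftpC; congr (_ + _).
rewrite !(@shiftp_wide (size q)) ?mul_polyC ?size_scale_leq//.
rewrite mulrz_suml; apply: eq_bigr => i _.
by rewrite coefZ -mulrzA mulrC.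
Qed.

Lemma shiftp_comp_Xn p k y g x :
  shiftp (p \Po 'X^k) y g x = shiftp p (y *+ k) g x.
Proof.
have shiftpMXn q : forall t, shiftp (q * 'X^k) y g t = shiftp q y g (t + y *+ k).
  elim: k => [|k IHk] t; first by rewrite mulr1 mulr0n addr0.
  by rewrite exprSr mulrA shiftpMX IHk mulrS addrA.
elim/poly_ind: p x => [|p c IHp] x; first by rewrite comp_poly0 /shiftp size_poly0 !big_ord0.
rewrite comp_polyD comp_polyM comp_polyX comp_polyC !shiftpD !shiftpC.
by rewrite shiftpMX shiftpMXn IHp.
Qed.

(** On a [y]-invariant function the translation acts as the identity, so that
    only the value of [p] at 1 remains. *)
Lemma shiftp_invariant p y h x : (forall t, h (t + y) = h t) ->
  shiftp p y h x = h x *~ p.[1].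
Proof.
move=> hy; elim/poly_ind: p x => [|p c IHp] x.
  by rewrite horner0 mulr0z /shiftp size_poly0 big_ord0.
rewrite shiftpD shiftpMX shiftpC IHp hy hornerD hornerM hornerX hornerC.
by rewrite mulr1 mulrzDr.
Qed.

Lemma fdiff_sum j y g x :
  fdiff j y g x
  = \sum_(i < j.+1) g (x + y *+ i) *~ ((-1) ^+ (j - i) * ('C(j, i))%:Z).
Proof. by apply: eq_bigr => i _; rewrite translateE. Qed.

Lemma fdiffE j y g x : fdiff j y g x = shiftp (('X - 1) ^+ j) y g x.
Proof.
rewrite fdiff_sum (@shiftp_wide j.+1) ?size_exp_XsubC//.
by apply: eq_bigr => i _; rewrite coef_XsubC1X// -ltnS.
Qed.

Lemma fdiffS j y g x :
  fdiff j.+1 y g x = fdiff j y g (x + y) - fdiff j y g x.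
Proof.
rewrite !fdiffE exprSr mulrBr mulr1 shiftpD shiftpMX; congr (_ + _).
by rewrite -mulrN1 mulrC -polyCN shiftp_mul shiftpC mulrN1z.
Qed.

(** With [T] the translation by [y], [(T^k - 1)^n] is [(1 + T + ... + T^(k-1))^n]
    times [(T - 1)^n], and the first factor acts on an invariant function as
    multiplication by [k ^ n]. *)
Lemma fdiff_mulrn j y g x k :
  (forall t, fdiff j y g (t + y) = fdiff j y g t) ->
  fdiff j (y *+ k) g x = fdiff j y g x *~ (k ^ j)%:Z.
Proof.
move=> gy; rewrite fdiffE -shiftp_comp_Xn rmorphXn/= rmorphB/= rmorph1/=.
rewrite comp_polyX subrX1 mulrC exprMn shiftp_mul.
rewrite (eq_shiftp _ _ _ (fun t => esym (fdiffE j y g t))) shiftp_invariant//.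
congr (_ *~ _); rewrite horner_exp horner_sum.
under eq_bigr do rewrite horner_exp hornerX expr1n.
by rewrite sumr_const card_ord -natz natrX.
Qed.

End ShiftPolynomials.

(** * The n-th difference of the n-th power *)

(** The operator [X d/dX], which multiplies the coefficient of degree [i] by [i]. *)
Definition euler_op (p : {poly int}) : {poly int} := 'X * p^`().

Lemma euler_op_coef n p i : (iter n euler_op p)`_i = p`_i * (i ^ n)%:Z.
Proof.
elim: n => [|n IHn]; first by rewrite mulr1.
rewrite iterS /euler_op mulrC coefMX.
case: i IHn => [|i] IHn; first by rewrite /= exp0n// mulr0.
by rewrite /= coef_deriv IHn -mulr_natr natz -mulrA -PoszM expnSr.
Qed.

(** Each application of the operator lowers by one the order of vanishing at 1. *)
Lemma euler_op_XsubC1 n q : (iter n euler_op (('X - 1) ^+ n * q)).[1] = q.[1] *+ n`!.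
Proof.
elim: n q => [|n IHn] q; first by rewrite mul1r.
rewrite iterSr.
have -> : euler_op (('X - 1) ^+ n.+1 * q)
    = ('X - 1) ^+ n * (n.+1%:R * 'X * q + ('X - 1) * 'X * q^`()).
  rewrite /euler_op derivM deriv_exp derivXsubC mul1r/= -mulr_natl exprS.
  by ring.
rewrite IHn hornerD !hornerM hornerXsubC subrr !mul0r addr0 hornerX mulr1.
by rewrite -polyC_natr hornerC mulr_natl -mulrnA factS.
Qed.

(** Both sides are the value at 1 of [('X - 1) ^+ n] after [n] applications of
    [X d/dX]. *)
Lemma alternating_sum_expn n :
  \sum_(k < n.+1) ((-1) ^+ (n - k) * ('C(n, k))%:Z) * (k ^ n)%:Z = n`!%:Z.
Proof.
have := euler_op_XsubC1 n 1; rewrite mulr1 hornerC natz => <-.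
have sz : (size (iter n euler_op (('X - 1) ^+ n)) <= n.+1)%N.
  apply/leq_sizeP => j nj; rewrite euler_op_coef.
  by rewrite nth_default ?mul0r// size_exp_XsubC.
rewrite (horner_coef_wide _ sz); apply: eq_bigr => k _.
by rewrite expr1n mulr1 euler_op_coef coef_XsubC1X ?ltn_ord// -ltnS ltn_ord.
Qed.

(** * Mixed differences *)

Section MixedDifferences.
Set Implicit Arguments.
Unset Strict Implicit.
Variables (X : nmodType) (Y : zmodType).
Implicit Types (g h : X -> Y) (x y a b : X).

(** The product of the operators [T^a - T^b] for [(a, b)] in [s].  Keeping both
    translations avoids opposites, which [X] need not have. *)
Definition gap_diff (s : seq (X * X)) g : X -> Y :=
  foldr (fun ab h x => h (x + ab.1) - h (x + ab.2)) g s.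

Definition mixed_diff (ys : seq X) g : X -> Y :=
  gap_diff [seq (y, 0) | y <- ys] g.

Lemma gap_diff0 s g x : (forall t, g t = 0) -> gap_diff s g x = 0.
Proof.
by move=> g0; elim: s x => [|[a b] s IHs] x //=; rewrite !IHs subrr.
Qed.

Lemma gap_diff_degenerate s g x a : (a, a) \in s -> gap_diff s g x = 0.
Proof.
elim: s x => [|[b c] s IHs] x //=; rewrite inE => /orP[/eqP[<- <-]|sa].
  by rewrite subrr.
by rewrite !IHs// subrr.
Qed.

Lemma gap_diff_shift (s : seq (X * X * X)) g x :
  gap_diff [seq (t.1.1 + t.2, t.1.2 + t.2) | t <- s] g x
  = gap_diff [seq t.1 | t <- s] g (x + \sum_(t <- s) t.2).
Proof.
elim: s x => [|[[a b] c] s IHs] x /=; first by rewrite big_nil addr0.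
rewrite big_cons !IHs; congr (gap_diff _ _ _ - gap_diff _ _ _);
  by rewrite -!addrA; congr (_ + _); rewrite addrC -addrA.
Qed.

(** All these operators are combinations of translations, which commute. *)
Lemma shiftp_gap_diff p y s g x :
  shiftp p y (gap_diff s g) x = gap_diff s (shiftp p y g) x.
Proof.
elim: s x => [|[a b] s IHs] x //=.
by rewrite shiftp_sub !shiftp_addr !IHs.
Qed.

(** Multiplying out the first factor [T^(k w) - T^(r w)] changes the affine
    translation [b + a k] into [b + (a + w) k] and [(b + w r) + a k]; when no
    factor is left, the sum is a difference with step [a]. *)
Lemma sum_gap_diff N (s : seq (X * nat)) g a b x :
  (forall t y, fdiff N y g t = 0) ->
  \sum_(k < N.+1) gap_diff [seq (w.1 *+ k, w.1 *+ w.2) | w <- s] g (x + b + a *+ k)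
     *~ ((-1) ^+ (N - k) * ('C(N, k))%:Z) = 0.
Proof.
move=> g0; elim: s a b => [|[w r] s IHs] a b /=.
  by apply: etrans (g0 (x + b) a); rewrite fdiff_sum.
have := congr2 (fun u v => u - v) (IHs (a + w) b) (IHs a (b + w *+ r)).
rewrite subrr -sumrB; apply: etrans; apply: eq_bigr => k _; rewrite mulrzBl.
by congr (gap_diff _ _ _ *~ _ - gap_diff _ _ _ *~ _);
  rewrite ?mulrnDl ?addrA// addrAC.
Qed.

Lemma fdiff_mixed N y g x : fdiff N y g x = mixed_diff (nseq N y) g x.
Proof.
elim: N x => [|N IHN] x.
  by rewrite /fdiff big_ord1 mul1r mulr1z.
by rewrite fdiffS !IHN /mixed_diff /= addr0.
Qed.

Definition divisible := forall (x : X) k, (0 < k)%N -> exists z, z *+ k = x.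

(** Djokovic's theorem, by the choice [w_r = ys_r / (N - r)]. *)
Lemma mixed_diff_eq0 N ys g : divisible -> size ys = N ->
  (forall x y, fdiff N y g x = 0) -> forall x, mixed_diff ys g x = 0.
Proof.
move=> dX szy g0.
have /boolp.choice[w Hw] r : exists z, (r < N)%N -> z *+ (N - r) = nth 0 ys r.
  case: (ltnP r N) => rN; last by exists 0.
  by have [|z zy] := dX (nth 0 ys r) (N - r)%N; [rewrite subn_gt0|exists z].
pose b := \sum_(r <- iota 0 N) w r *+ r.
(* The summands k < N of [sum_gap_diff] have a degenerate factor r = k. *)
have far x : mixed_diff ys g (x + b) = 0.
  pose s := [seq (w r, r) | r <- iota 0 N].
  have := sum_gap_diff s 0 0 x g0; rewrite big_ord_recr/= big1 => [|k _].
    rewrite add0r subnn binn mulr1 mulr1z mul0rn !addr0 -map_comp/= => E.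
    apply: etrans E.
    pose s' := [seq ((w r *+ (N - r), 0 : X), w r *+ r) | r <- iota 0 N].
    transitivity (gap_diff [seq t.1 | t <- s'] g (x + \sum_(t <- s') t.2)).
      rewrite big_map -map_comp/=; congr gap_diff.
      rewrite -[ys in LHS](mkseq_nth 0) szy -map_comp.
      by apply/eq_in_map => r; rewrite mem_iota => rN; rewrite /= Hw.
    rewrite -gap_diff_shift -map_comp/=; congr gap_diff.
    apply/eq_in_map => r; rewrite mem_iota add0n => /= rN.
    by rewrite -mulrnDr subnK 1?ltnW// add0r.
  rewrite (@gap_diff_degenerate _ _ _ (w k *+ k)) ?mul0rz//.
  apply/mapP; exists (w k, k : nat) => //; apply/mapP; exists (k : nat) => //.
  by rewrite mem_iota add0n ltn_ord.
(* In the difference of order N and step b of the mixed difference, every value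
   except the one at x is taken beyond a translation by b. *)
move=> x.
have : fdiff N b (mixed_diff ys g) x = 0.
  rewrite fdiffE shiftp_gap_diff gap_diff0// => t; by rewrite -fdiffE.
rewrite fdiff_sum big_ord_recl big1 => [|i _].
  rewrite /= subn0 bin0 mulr1 mulr0n !addr0 -signr_odd.
  by case: odd => /eqP; rewrite ?expr1 ?mulrN1z ?mulr1z ?oppr_eq0 => /eqP.
by rewrite /= /bump/= mulrSr addrA far mul0rz.
Qed.

End MixedDifferences.

(** * Frechet's equation on a divisible monoid *)

Section FrechetEquation.
Set Implicit Arguments.
Unset Strict Implicit.
Variables (X : nmodType) (Y : zmodType).
Implicit Types (g h rho : X -> Y) (x y z : X).

Lemma fdiff_sub N y g h x :
  fdiff N y (fun t => g t - h t) x = fdiff N y g x - fdiff N y h x.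
Proof. by rewrite !fdiffE shiftp_sub. Qed.

Lemma fdiff_top_invariant n g : divisible X ->
  (forall x y, fdiff n.+1 y g x = 0) ->
  forall x y z, fdiff n y g (x + z) = fdiff n y g x.
Proof.
move=> dX g0 x y z; apply/eqP; rewrite -subr_eq0; apply/eqP.
rewrite -[RHS](@mixed_diff_eq0 _ _ n.+1 (z :: nseq n y) g dX _ g0 x); last first.
  by rewrite /= size_nseq.
by rewrite !fdiff_mixed /mixed_diff/= addr0.
Qed.

(** [n!] times the [n]-th difference of [rho] with step [y] at [x] is a double sum
    of values [g (k (x + i y))].  Summed over [i] first, it consists of the
    differences of [g] with steps [k y], hence of [k ^ n * fdiff n y g 0]. *)
Lemma monomial_top n g rho :
  injective (fun w : Y => w *+ n`!) ->
  (forall x y z, fdiff n y g (x + z) = fdiff n y g x) ->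
  (forall y, rho y *+ n`! = fdiff n y g 0) -> monomial n rho.
Proof.
move=> inj_fact gt rhoE.
have fdiff0 y x : fdiff n y g x = fdiff n y g 0 by rewrite -[x]add0r gt.
move=> x y; apply: inj_fact; rewrite /= rhoE.
transitivity (\sum_(i < n.+1) \sum_(k < n.+1)
    g (x *+ k + (y *+ k) *+ i) *~ ((-1) ^+ (n - k) * ('C(n, k))%:Z)
      *~ ((-1) ^+ (n - i) * ('C(n, i))%:Z)).
  rewrite fdiff_sum -sumrMnl; apply: eq_bigr => i _.
  rewrite pmulrn -mulrzA mulrC mulrzA -pmulrn rhoE fdiff_sum mulrz_suml.
  by apply: eq_bigr => k _; rewrite add0r mulrnDl -!mulrnA [(i * k)%N]mulnC.
rewrite exchange_big/= pmulrn -alternating_sum_expn mulrz_sumr; apply: eq_bigr => k _.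
rewrite -[in RHS]mulrzA_C -fdiff_mulrn// -(fdiff0 _ (x *+ k)) fdiff_sum mulrz_suml.
by apply: eq_bigr => i _; rewrite -!mulrzA mulrC.
Qed.

(** [fdiff i y rho] is constant, and [('X - 1) ^+ (n.+1 - i)] vanishes at 1. *)
Lemma fdiff_monomial n i y rho x : monomial i rho -> (i <= n)%N ->
  fdiff n.+1 y rho x = 0.
Proof.
move=> rhoP le_in; rewrite fdiffE -(subnK (leqW le_in)) exprD shiftp_mul.
have rho_cst t : shiftp (('X - 1) ^+ i) y rho t = rho y *+ i`!.
  by rewrite -fdiffE rhoP.
rewrite shiftp_invariant => [|t]; last by rewrite !rho_cst.
by rewrite subSn// horner_exp hornerXsubC subrr exprS mul0r mulr0z.
Qed.

Lemma fact_divisibleW n : fact_divisible n.+1 Y -> fact_divisible n Y.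
Proof.
case=> d dK Kd; exists (fun w => d (w *+ n.+1)) => w.
  by rewrite -[RHS]dK /= -mulrnA factS mulnC.
rewrite /= -[w in LHS]Kd mulrnAC dK -mulrnA -factS; exact: Kd.
Qed.

Lemma monomial_decomposition n g : divisible X -> fact_divisible n Y ->
  (forall x y, fdiff n.+1 y g x = 0) ->
  exists rho : nat -> X -> Y, (forall i, (i <= n)%N -> monomial i (rho i)) /\
    (forall x, g x = \sum_(i < n.+1) rho i x).
Proof.
move=> dX; elim: n g => [|n IHn] g dY g0.
  exists (fun=> g); split=> [i|x]; last by rewrite big_ord1.
  rewrite leqn0 => /eqP-> x y; rewrite fdiff_sum big_ord1 mulr1z mulr0n addr0.
  have gt z : g z = g 0.
    have := fdiff_top_invariant dX g0 0 0 z.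
    by rewrite !fdiff_sum !big_ord1 !mulr1z !mulr0n !addr0 add0r.
  by rewrite gt -(gt y).
have [d dK Kd] := dY.
pose top y := d (fdiff n.+1 y g 0).
have gt := fdiff_top_invariant dX g0.
have topP : monomial n.+1 top.
  by apply: (monomial_top (can_inj dK) gt) => y; rewrite /top Kd.
have [|x y|rho [rhoP rhoE]] := IHn (fun x => g x - top x).
- exact: fact_divisibleW.
- by rewrite fdiff_sub topP /top Kd -[x]add0r gt subrr.
exists (fun i => if i == n.+1 then top else rho i); split=> [i|x].
  by rewrite leq_eqVlt; case: eqP => [->//|_] /=; apply: rhoP.
rewrite big_ord_recr/= eqxx -[LHS](subrK (top x)) rhoE; congr (_ + _).
by apply: eq_bigr => i _; rewrite ltn_eqF.
Qed.

Lemma alternating_sumE n y g x :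
  \sum_(0 <= i < n.+2) g (x + y *+ i) *~ ((-1) ^+ i * ('C(n.+1, i))%:Z)
  = fdiff n.+1 y g x *~ (-1) ^+ n.+1.
Proof.
rewrite fdiff_sum mulrz_suml big_mkord; apply: eq_bigr => i _.
rewrite -mulrzA; congr (_ *~ _).
have -> : (-1 : int) ^+ n.+1 = (-1) ^+ (n.+1 - i) * (-1) ^+ i.
  by rewrite -exprD subnK// -ltnS.
by rewrite mulrACA -expr2 sqrr_sign mul1r mulrC.
Qed.

(** The map [pw] stands for the power and [rt] for the root.  Taking [v] over 0
    shows that a solution [f] factors through [pw]: this is what forces [f] to be
    even when [m] is even. *)
Lemma frechet_pullback (U : Type) (pw : U -> X) (rt : X -> U) n (f : U -> Y) :
  divisible X -> fact_divisible n Y -> cancel rt pw ->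
  (forall u v, f u + \sum_(1 <= i < n.+2) f (rt (pw u + pw v *+ i))
     *~ ((-1) ^+ i * ('C(n.+1, i))%:Z) = 0)
  <-> (exists rho : 'I_n.+1 -> X -> Y, (forall i : 'I_n.+1, monomial i (rho i)) /\
        (forall u, f u = \sum_(i < n.+1) rho i (pw u))).
Proof.
move=> dX dY rtK; pose g := f \o rt.
have splitE x y : g x + \sum_(1 <= i < n.+2) g (x + y *+ i)
    *~ ((-1) ^+ i * ('C(n.+1, i))%:Z) = fdiff n.+1 y g x *~ (-1) ^+ n.+1.
  by rewrite -alternating_sumE [RHS]big_ltn// mulr0n addr0 bin0 mulr1.
split=> [f0|[rho [rhoP rhoE]] u v].
  have fE u : f u = g (pw u).
    have := f0 u (rt 0); rewrite rtK; have := splitE (pw u) 0.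
    rewrite fdiffE shiftp_invariant => [|t]; last by rewrite addr0.
    rewrite horner_exp hornerXsubC subrr exprS mul0r mulr0z mul0rz.
    by move=> gE0 fE0; apply: addIr (etrans fE0 (esym gE0)).
  have g0 x y : fdiff n.+1 y g x = 0.
    have : fdiff n.+1 y g x *~ (-1) ^+ n.+1 = 0.
      by rewrite -splitE; have := f0 (rt x) (rt y); rewrite !rtK.
    rewrite -signr_odd.
    by case: odd => /eqP; rewrite ?expr1 ?mulrN1z ?mulr1z ?oppr_eq0 => /eqP.
  have [rho [rhoP rhoE]] := monomial_decomposition dX dY g0.
  exists (fun i => rho i); split=> [i|u]; first by apply: rhoP; rewrite -ltnS.
  by rewrite fE rhoE.
have gE x : g x = \sum_(i < n.+1) rho i x by rewrite /g/= rhoE rtK.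
have -> : f u = g (pw u) by rewrite gE rhoE.
rewrite splitE fdiff_sum (_ : \sum_(i < n.+2) _ = 0) ?mul0rz//.
transitivity (\sum_(i < n.+1) fdiff n.+1 (pw v) (rho i) (pw u)); last first.
  by rewrite big1// => i _; rewrite (fdiff_monomial _ _ (rhoP i))// -ltnS.
under [RHS]eq_bigr do rewrite fdiff_sum.
by rewrite exchange_big; apply: eq_bigr => k _; rewrite gE mulrz_suml.
Qed.

End FrechetEquation.

(** * The real line and the half-line *)

Lemma real_divisible (R : realType) : divisible (R : nmodType).
Proof.
move=> x k k0; exists (x / k%:R).
by rewrite -[LHS]mulr_natr mulfVK// pnatr_eq0 -lt0n.
Qed.

Lemma val_halflineD (R : realType) (x y : halfline R) :
  \val (x + y) = \val x + \val y.
Proof. exact: raddfD. Qed.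

Lemma val_halflineMn (R : realType) (x : halfline R) k :
  \val (x *+ k) = \val x *+ k.
Proof. exact: raddfMn. Qed.

Lemma halfline_divisible (R : realType) : divisible (halfline R).
Proof.
move=> x k k0.
have xk : \val x / k%:R \is Num.nneg by rewrite nnegrE divr_ge0//; have := valP x.
exists (exist _ (\val x / k%:R) xk); apply: val_inj.
by rewrite val_halflineMn /= -[LHS]mulr_natr mulfVK// pnatr_eq0 -lt0n.
Qed.

Theorem theorem3p2 (R : realType) (m n : nat) (Y : zmodType) (f : R -> Y) :
  (2 <= m)%N -> (1 <= n)%N -> fact_divisible n Y ->
  (forall u v : R,
      f u + \sum_(1 <= i < n.+2)
              f (real_root m (u ^+ m + i%:R * v ^+ m))
                *~ ((-1) ^+ i * ('C(n.+1, i))%:Z) = 0)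
  <->
  (exists rho : 'I_n.+1 -> domX R (odd m) -> Y,
      (forall i : 'I_n.+1, monomial i (rho i)) /\
      (forall u : R, f u = \sum_(i < n.+1) rho i (powX m u))).
Proof.
move=> m2 _ dY; have m0 : (0 < m)%N by apply: ltnW.
suff by_parity b (mb : odd m = b) : (forall u v : R,
      f u + \sum_(1 <= i < n.+2)
              f (real_root m (u ^+ m + i%:R * v ^+ m))
                *~ ((-1) ^+ i * ('C(n.+1, i))%:Z) = 0)
    <-> (exists rho : 'I_n.+1 -> domX R b -> Y,
      (forall i : 'I_n.+1, monomial i (rho i)) /\
      (forall u : R, f u = \sum_(i < n.+1) rho i (powX_parity u mb))).
  exact: by_parity.
case: b mb => mb.
  have rtK : cancel (real_root m) (fun t : R => t ^+ m).
    by have [] := real_root_odd_bij R mb.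
  apply: iff_trans (frechet_pullback f (@real_divisible R) dY rtK).
  by split=> H u v; apply: etrans (H u v); congr (_ + _); apply: eq_bigr => i _;
    rewrite mulr_natl.
have rtK : cancel (fun x : halfline R => real_root m (\val x))
    (fun u => powX_parity u mb).
  move=> x; apply: val_inj => /=; have x0 : 0 <= \val x by have := valP x.
  by have [|//] := @real_root_spec R m (\val x) m0; rewrite x0 orbT.
apply: iff_trans (frechet_pullback f (@halfline_divisible R) dY rtK).
by split=> H u v; apply: etrans (H u v); congr (_ + _); apply: eq_bigr => i _;
  rewrite val_halflineD val_halflineMn mulr_natl.
Qed.
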